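(* Consider $n=2$ agents, $k=1$ unit, and the residual surplus objective. Let $M$ be the ratio auction with ratio $\alpha=2$ and bias $\chi=3/4$. Then $M$ is universally adopted with competitive advantage $4/3$: for every valuation profile $\mathbf v=(v_1,v_2)\in[0,\infty)^2$, the expected residual surplus satisfies $$M(\mathbf v)\ \ge\ \tfrac34\,\mathcal G(\mathbf v).$$
   Context: One item is allocated to one of two agents with values $v_1,v_2\ge 0$. A mechanism has allocation probabilities $x_i(\mathbf v)\in[0,1]$ with $x_1+x_2\le1$, non-decreasing in the agent's own value, and expected payments $p_i(\mathbf v)=v_i x_i(\mathbf v)-\int_0^{v_i}x_i(z,v_{-i})\,dz$. Its expected residual surplus is $M(\mathbf v)=\sum_i (v_i x_i(\mathbf v)-p_i(\mathbf v))$. Ratio auction with ratio $\alpha\ge1$ and bias $\chi\in[1/2,1]$: if the two values are within a factor $\alpha$ of each other the item is allocated by a fair coin ($x_1=x_2=\tfrac12$); otherwise it is allocated by a biased coin, to the higher-valued agent with probability $\chi$ and to the other agent with probability $1-\chi$. For $\alpha=2,\chi=3/4$ this is equivalent to setting $w_1=1$, drawing $w_2$ uniformly from $\{0,1/2,2,\infty\}$, and running the weighted Vickrey auction that serves the agent maximizing $w_iv_i$. Benchmark. $\mathcal G(\mathbf v)$ is the supremum, over continuous distributions $F$, of the residual surplus on $\mathbf v$ of the symmetric residual-surplus-optimal mechanism for values i.i.d. from $F$. For two agents and one unit it equals $$\mathcal G(\mathbf v)=\max\left\{\tfrac{v_1+v_2}{2},\ v_{(1)}-\tfrac{v_{(2)}}{2}\right\},$$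 where $v_{(1)}\ge v_{(2)}$ are the sorted values; this formula may be used as its definition. *)

(* Defs.v *)
(* Stdlib reals with Coquelicot's total Riemann integral [RInt]. *)
From Stdlib Require Import Reals Lra.
From Coquelicot Require Import Coquelicot.
Open Scope R_scope.

Inductive agent : Set := agent1 | agent2.

Definition other (i : agent) : agent :=
  match i with agent1 => agent2 | agent2 => agent1 end.

Definition agent_eq_dec (i j : agent) : {i = j} + {i <> j}.
Proof. decide equality. Defined.

Definition sum_agents (f : agent -> R) : R := f agent1 + f agent2.

Definition profile : Set := agent -> R.

Definition valid (v : profile) : Prop := forall i, 0 <= v i.

(* [set_value v i z] is the profile written (z, v_{-i}). *)
Definition set_value (v : profile) (i : agent) (z : R) : profile :=
  fun j => if agent_eq_dec j i then z else v j.

(* Only the behaviour on valid (nonnegative) profiles is constrained. *)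
Record mechanism : Type := Mechanism {
  alloc : agent -> profile -> R;
  alloc_range : forall i v, valid v -> 0 <= alloc i v <= 1;
  alloc_feasible : forall v, valid v -> sum_agents (fun i => alloc i v) <= 1;
  alloc_monotone : forall i v z z', valid v -> 0 <= z <= z' ->
    alloc i (set_value v i z) <= alloc i (set_value v i z')
}.

(* On a valid profile the integrand is monotone on [0, v i], hence Riemann
   integrable, so [RInt] is never a default value there. *)
Definition payment (M : mechanism) (i : agent) (v : profile) : R :=
  v i * alloc M i v - RInt (fun z => alloc M i (set_value v i z)) 0 (v i).

Definition residual_surplus (M : mechanism) (v : profile) : R :=
  sum_agents (fun i => v i * alloc M i v - payment M i v).

(* The factor is inclusive, and (0, 0) counts as within any factor. *)
Definition within_factor_dec (alpha a b : R) :
  {a <= alpha * b /\ b <= alpha * a} + {~ (a <= alpha * b /\ b <= alpha * a)}.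
Proof.
  destruct (Rle_dec a (alpha * b)) as [H1|H1].
  - destruct (Rle_dec b (alpha * a)) as [H2|H2].
    + left; split; assumption.
    + right; intros [_ H]; exact (H2 H).
  - right; intros [H _]; exact (H1 H).
Defined.

Definition ratio_alloc (alpha chi : R) (i : agent) (v : profile) : R :=
  if within_factor_dec alpha (v i) (v (other i)) then 1 / 2
  else if Rlt_dec (v (other i)) (v i) then chi
  else 1 - chi.

Lemma ratio_alloc_range (alpha chi : R) (Hchi : 1 / 2 <= chi <= 1) i v :
  valid v -> 0 <= ratio_alloc alpha chi i v <= 1.
Proof.
  intros _; unfold ratio_alloc.
  destruct within_factor_dec; [lra|]; destruct Rlt_dec; lra.
Qed.

Lemma ratio_alloc_feasible (alpha chi : R) (Halpha : 1 <= alpha) v :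
  valid v -> sum_agents (fun i => ratio_alloc alpha chi i v) <= 1.
Proof.
  intros Hv; pose proof (Hv agent1) as H1; pose proof (Hv agent2) as H2.
  unfold sum_agents, ratio_alloc; simpl.
  destruct (within_factor_dec alpha (v agent1) (v agent2)) as [W|W];
    destruct (within_factor_dec alpha (v agent2) (v agent1)) as [W'|W'];
    try tauto; try lra.
  destruct (Rlt_dec (v agent2) (v agent1));
    destruct (Rlt_dec (v agent1) (v agent2)); try lra.
  exfalso; apply W; assert (v agent1 = v agent2) as -> by lra; nra.
Qed.

Lemma ratio_alloc_monotone (alpha chi : R) (Halpha : 1 <= alpha)
    (Hchi : 1 / 2 <= chi <= 1) i v z z' :
  valid v -> 0 <= z <= z' ->
  ratio_alloc alpha chi i (set_value v i z)
    <= ratio_alloc alpha chi i (set_value v i z').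
Proof.
  intros Hv Hz; pose proof (Hv (other i)) as Hb.
  assert (Hi : forall w, set_value v i w i = w)
    by (intros w; unfold set_value; destruct i; reflexivity).
  assert (Ho : forall w, set_value v i w (other i) = v (other i))
    by (intros w; unfold set_value; destruct i; reflexivity).
  unfold ratio_alloc; rewrite !Hi, !Ho; revert Hb; generalize (v (other i)).
  intros b Hb.
  destruct (within_factor_dec alpha z b) as [W|W];
    destruct (within_factor_dec alpha z' b) as [W'|W'];
    destruct (Rlt_dec b z); destruct (Rlt_dec b z'); try lra;
    exfalso; first [apply W; split; nra | apply W'; split; nra].
Qed.

Definition ratio_auction (alpha chi : R) (Halpha : 1 <= alpha)
    (Hchi : 1 / 2 <= chi <= 1) : mechanism :=
  Mechanism (ratio_alloc alpha chi)
    (ratio_alloc_range alpha chi Hchi)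
    (ratio_alloc_feasible alpha chi Halpha)
    (ratio_alloc_monotone alpha chi Halpha Hchi).

Lemma one_le_two : 1 <= 2.
Proof. lra. Qed.

Lemma three_quarters_bias : 1 / 2 <= 3 / 4 <= 1.
Proof. lra. Qed.

(* Closed form, for two agents and one unit, of the supremum over continuous
   F of the residual surplus on v of the symmetric mechanism that is
   residual-surplus optimal for values i.i.d. from F. *)
Definition benchmark (v : profile) : R :=
  Rmax ((v agent1 + v agent2) / 2)
       (Rmax (v agent1) (v agent2) - Rmin (v agent1) (v agent2) / 2).

(* Main.v *)
(* The allocation to an agent, as a function of its own value z, is a step
   function with steps at b/2 and 2b, where b is the other agent's value; its
   integral is the agent's surplus.  Summing the two surpluses, the bound holds
   with equality: both sides are (3/8)(v1 + v2) when the values are within a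
   factor 2, and (3/4)(v(1) - v(2)/2) otherwise. *)
Require Import Defs.
From Stdlib Require Import Reals Lra Psatz.
From Coquelicot Require Import Coquelicot.
Open Scope R_scope.

(** Asking for constancy only on the open interval keeps the tie rule at the breakpoints of the
    allocation out of the integrals. *)
Lemma is_RInt_const_on (f : R -> R) (a b c : R) :
  a <= b -> (forall x, a < x < b -> f x = c) -> is_RInt f a b ((b - a) * c).
Proof.
  intros Hab Hf.
  apply (is_RInt_ext (fun _ => c)); [|exact (is_RInt_const a b c)].
  intros x Hx; rewrite Rmin_left, Rmax_right in Hx by assumption.
  symmetry; apply Hf, Hx.
Qed.

Lemma ratio_alloc_set_value (alpha chi : R) (i : agent) (v : profile) (z : R) :
  ratio_alloc alpha chi i (set_value v i z)
  = if within_factor_dec alpha z (v (other i)) then 1 / 2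
    else if Rlt_dec (v (other i)) z then chi else 1 - chi.
Proof. destruct i; reflexivity. Qed.

Section Surplus.

Variables (alpha chi : R) (i : agent) (v : profile).
Hypotheses (Halpha : 1 <= alpha) (Hv : valid v).

Let b := v (other i).
Let x (z : R) := ratio_alloc alpha chi i (set_value v i z).

(** Below [b / alpha] the other value exceeds [alpha] times the agent's own, so the agent is on the
    losing side of the biased coin. *)
Lemma is_RInt_ratio_alloc_low (a : R) :
  0 <= a <= b / alpha -> is_RInt x 0 a ((1 - chi) * a).
Proof.
  intros Ha; assert (Hb : b / alpha * alpha = b) by (field; lra).
  replace ((1 - chi) * a) with ((a - 0) * (1 - chi)) by ring.
  apply is_RInt_const_on; [lra|]; intros z Hz.
  unfold x; rewrite ratio_alloc_set_value; fold b.
  destruct within_factor_dec as [W|W]; [nra|].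
  destruct Rlt_dec; [nra|reflexivity].
Qed.

Lemma is_RInt_ratio_alloc_mid (a : R) :
  b / alpha <= a <= alpha * b ->
  is_RInt x 0 a ((1 - chi) * (b / alpha) + (a - b / alpha) / 2).
Proof.
  intros Ha; assert (Hb : b / alpha * alpha = b) by (field; lra).
  assert (Hb0 : 0 <= b / alpha)
    by (apply Rdiv_le_0_compat; [exact (Hv (other i))|lra]).
  apply (is_RInt_Chasles x 0 (b / alpha) a);
    [apply is_RInt_ratio_alloc_low; lra|].
  replace ((a - b / alpha) / 2) with ((a - b / alpha) * (1 / 2)) by lra.
  apply is_RInt_const_on; [lra|]; intros z Hz.
  unfold x; rewrite ratio_alloc_set_value; fold b.
  destruct within_factor_dec as [W|W]; [reflexivity|].
  exfalso; apply W; split; nra.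
Qed.

Lemma is_RInt_ratio_alloc_high (a : R) :
  alpha * b <= a ->
  is_RInt x 0 a ((1 - chi) * (b / alpha) + (alpha * b - b / alpha) / 2
                 + (a - alpha * b) * chi).
Proof.
  intros Ha; assert (Hb : b / alpha * alpha = b) by (field; lra).
  assert (Hb0 : 0 <= b / alpha)
    by (apply Rdiv_le_0_compat; [exact (Hv (other i))|lra]).
  (* Ordering the breakpoints as [b / alpha <= b <= alpha * b] makes the middle formula apply up to
     [alpha * b] and makes the agent the higher one beyond it. *)
  assert (Hb1 : b / alpha <= b) by nra.
  assert (Hb2 : b <= alpha * b) by nra.
  apply (is_RInt_Chasles x 0 (alpha * b) a);
    [apply is_RInt_ratio_alloc_mid; fold b; lra|].
  apply is_RInt_const_on; [lra|]; intros z Hz.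
  unfold x; rewrite ratio_alloc_set_value; fold b.
  destruct within_factor_dec as [W|W]; [lra|].
  destruct Rlt_dec; [reflexivity|lra].
Qed.

End Surplus.

(** The terms [v i * alloc M i v] cancel against the payments. *)
Lemma residual_surplus_RInt (M : mechanism) (v : profile) :
  residual_surplus M v
  = sum_agents (fun i => RInt (fun z => alloc M i (set_value v i z)) 0 (v i)).
Proof. unfold residual_surplus, payment, sum_agents; ring. Qed.

Theorem lemma5p2 (v : profile) (Hv : valid v) :
  residual_surplus (ratio_auction 2 (3 / 4) one_le_two three_quarters_bias) v
    >= 3 / 4 * benchmark v.
Proof.
  rewrite residual_surplus_RInt; unfold sum_agents, benchmark; simpl alloc.
  assert (low := fun i H => is_RInt_unique _ _ _ _
    (is_RInt_ratio_alloc_low 2 (3 / 4) i v one_le_two (v i) H)).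
  assert (mid := fun i H => is_RInt_unique _ _ _ _
    (is_RInt_ratio_alloc_mid 2 (3 / 4) i v one_le_two Hv (v i) H)).
  assert (high := fun i H => is_RInt_unique _ _ _ _
    (is_RInt_ratio_alloc_high 2 (3 / 4) i v one_le_two Hv (v i) H)).
  pose proof (Hv agent1) as H1; pose proof (Hv agent2) as H2.
  (* The two terms of the benchmark cross exactly where one value is twice the other, so these cases
     also decide its maximum. *)
  destruct (Rle_dec (v agent1) (v agent2 / 2)) as [L|L];
    [|destruct (Rle_dec (v agent2) (v agent1 / 2)) as [L'|L']].
  (* The surpluses are [v1 / 4] and [3/4 * v2 - 5/8 * v1]. *)
  - rewrite (low agent1), (high agent2) by (simpl; lra); simpl.
    unfold Rmax, Rmin; repeat destruct Rle_dec; lra.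
  - rewrite (high agent1), (low agent2) by (simpl; lra); simpl.
    unfold Rmax, Rmin; repeat destruct Rle_dec; lra.
  (* Each agent's surplus is half its own value minus an eighth of the other's. *)
  - rewrite (mid agent1), (mid agent2) by (simpl; lra); simpl.
    unfold Rmax, Rmin; repeat destruct Rle_dec; lra.
Qed.
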